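(* Let $\mathcal H$ be an infinite dimensional separable complex Hilbert space and let $T$ be a bounded linear operator on $\mathcal H$. Suppose that $T$ satisfies the Diskcyclicity Criterion with respect to a sequence $\{\lambda_{n_k}\}$. Suppose that at least one of the following conditions holds: (1) $T$ satisfies Condition $\mathcal B_1$ for the sequence $\{\lambda_{n_k}\}$, i.e. there is an infinite dimensional closed linear subspace $\mathcal B_1\subset\mathcal H$ such that $\|\lambda_{n_k}T^{n_k}z\|\to 0$ as $k\to\infty$ for every $z\in\mathcal B_1$; (2) there is an infinite dimensional closed linear subspace $\mathcal A\subset\mathcal H$ such that, for every $z\in\mathcal A$, the sequence $\{\|\lambda_{n_k}T^{n_k}z\|\}_k$ is bounded. Then there is an infinite dimensional closed linear subspace of $\mathcal H$ all of whose non-zero elements are diskcyclic vectors for $T$.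
   Context: A vector $x\in\mathcal H$ is diskcyclic for $T$ if $\{\alpha T^n x : n\ge 0,\ \alpha\in\mathbb C,\ |\alpha|\le 1\}$ is dense in $\mathcal H$. $T$ satisfies the Diskcyclicity Criterion with respect to the sequence $\{\lambda_{n_k}\}$, where $\{n_k\}$ is an increasing sequence of positive integers and $\{\lambda_{n_k}\}$ is a sequence in $\mathbb C\setminus\{0\}$ with $|\lambda_{n_k}|\le 1$ for all $k$, if there exist two dense sets $X,Y\subset\mathcal H$ and a sequence of maps $S_{n_k}:Y\to\mathcal H$ (not assumed linear or continuous) such that, as $k\to\infty$: (1) $\|\lambda_{n_k}T^{n_k}x\|\to 0$ for all $x\in X$; (2) $\|\frac{1}{\lambda_{n_k}}S_{n_k}y\|\to 0$ for all $y\in Y$; (3) $T^{n_k}S_{n_k}y\to y$ for all $y\in Y$. *)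

(* Defs.v *)
From HB Require Import structures.
From mathcomp Require Import all_boot all_order all_algebra.
From mathcomp Require Export complex.
From mathcomp Require Import all_classical all_reals all_analysis.

Set Implicit Arguments.
Unset Strict Implicit.
Unset Printing Implicit Defensive.

Import Order.TTheory GRing.Theory Num.Theory.
Import numFieldNormedType.Exports.

Local Open Scope classical_set_scope.
Local Open Scope ring_scope.
Local Open Scope complex_scope.

Section Subspaces.
Variables (R : realType) (H : completeNormedModType R[i]).

(* With [H] complete, this makes [H] a complex Hilbert space with inner
   product [ip], linear in its first argument. *)
Definition norm_from_dot (ip : {dot H for Num.conj}) : Prop :=
  forall x : H, `|x| ^+ 2 = ip x x.

Definition separable_space : Prop :=
  exists D : set H, countable D /\ dense D.

Definition finite_dimensional (M : set H) : Prop :=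
  exists (n : nat) (v : 'I_n -> H),
    (forall i, M (v i)) /\
    (forall x, M x -> exists a : 'I_n -> R[i], x = \sum_(i < n) a i *: v i).

Definition infinite_dimensional (M : set H) : Prop := ~ finite_dimensional M.

Definition inf_dim_closed_subspace (M : set H) : Prop :=
  [/\ submod_closed [in M], closed M & infinite_dimensional M].

End Subspaces.

(* The norm of [H] is valued in [R[i]], ordered by real part at equal imaginary
   part, so a bound [`|x| <= C] forces [C] to be a nonnegative real. [R[i]^o] is
   [R[i]] with the topology of its modulus. *)
Section Diskcyclicity.
Variables (R : realType) (H : completeNormedModType R[i]) (T : {linear H -> H}).

Definition bounded_operator : Prop :=
  exists C : R[i], forall x, `|T x| <= C * `|x|.

Definition diskcyclic_vector (x : H) : Prop :=
  dense [set y : H | exists (n : nat) (alpha : R[i]),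
                       `|alpha| <= 1 /\ y = alpha *: iter n T x].

(* Only the values [lam (n k)] and [S (n k)] of [lam] and [S] matter, and only
   the values of the latter on [Y]. *)
Definition diskcyclicity_criterion (n : nat -> nat) (lam : nat -> R[i]) : Prop :=
  [/\ {homo n : i j / (i < j)%N},
      forall k, (0 < n k)%N,
      forall k, lam (n k) != 0 /\ `|lam (n k)| <= 1 &
      exists (X Y : set H) (S : nat -> H -> H),
        [/\ dense X /\ dense Y,
            forall x, X x ->
              `|lam (n k) *: iter (n k) T x| @[k --> \oo] --> (0 : R[i]^o),
            forall y, Y y ->
              `|(lam (n k))^-1 *: S (n k) y| @[k --> \oo] --> (0 : R[i]^o) &
            forall y, Y y ->
              iter (n k) T (S (n k) y) @[k --> \oo] --> y]].

Definition condition_B1 (n : nat -> nat) (lam : nat -> R[i]) : Prop :=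
  exists B1 : set H, inf_dim_closed_subspace B1 /\
    forall z, B1 z ->
      `|lam (n k) *: iter (n k) T z| @[k --> \oo] --> (0 : R[i]^o).

Definition bounded_orbits_condition (n : nat -> nat) (lam : nat -> R[i]) : Prop :=
  exists A : set H, inf_dim_closed_subspace A /\
    forall z, A z ->
      exists C : R[i], forall k, `|lam (n k) *: iter (n k) T z| <= C.

End Diskcyclicity.

(* Main.v *)
(* With L_k = lam_(n_k) T^(n_k), condition (1) implies condition (2), so assume
   (2).  By uniform boundedness, the L_k have a common bound on A.  Let (e_j) be
   an orthonormal sequence in A.  We perturb the identity of its closed span by
     V x = x + sum_p (<x, e_p> d_p + <x, e_(m p)> u_p),
   where d_p moves e_p into X, u_p is a small vector of X that some L_(k_p) sends
   close to a target w_p, and every pair (index m p, target w_p) recurs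
   infinitely often along a dense sequence of targets.  Choosing e_p + d_p, k_p
   and u_p inductively makes every other term of L_(k_i) (V x) negligible: those
   with p < i because L_k -> 0 on X, those with p > i because d_p and u_p are
   tiny, and the tail of x itself because the L_k are uniformly bounded on A.
   Hence L_(k_i) (V x) is close to <x, e_(m i)> w_i, and the orbit of V x is
   dense as soon as some coefficient of x is nonzero.  As the perturbation has
   norm at most 1/2, V is bounded below and its range is the required closed
   infinite-dimensional subspace. *)

From HB Require Import structures.
Require Import Defs.
From mathcomp Require Import all_boot all_order all_algebra.
From mathcomp Require Import all_classical all_reals all_analysis.
From mathcomp Require Import ring lra.
Import Order.TTheory GRing.Theory Num.Theory.
Import numFieldNormedType.Exports.
Local Open Scope classical_set_scope.
Local Open Scope ring_scope.
Local Open Scope complex_scope.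

Set Implicit Arguments.
Unset Strict Implicit.
Unset Printing Implicit Defensive.

(** * The real-valued norm *)

(** The norm of [V] is valued in [R[i]], which is only partially ordered. Its real part loses no
    information and lies in [R], where linear arithmetic applies. *)
Definition rnorm (R : realType) (V : normedZmodType R[i]) (x : V) : R :=
  complex.Re `|x|.

Section RealNorm.
Variables (R : realType) (V : normedModType R[i]).
Implicit Types (x y : V) (a : R[i]).

Lemma rnormE (W : normedZmodType R[i]) (x : W) : (rnorm x)%:C = `|x|.
Proof. by rewrite /rnorm RRe_real // ger0_real. Qed.

Lemma le_rnorm (W W' : normedZmodType R[i]) (x : W) (y : W') :
  (rnorm x <= rnorm y) = (`|x| <= `|y|).
Proof. by rewrite -!rnormE lecR. Qed.

Lemma rnorm_ge0 (W : normedZmodType R[i]) (x : W) : 0 <= rnorm x.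
Proof. by rewrite -lecR rnormE normr_ge0. Qed.

Lemma rnorm0 : rnorm (0 : V) = 0.
Proof. by rewrite /rnorm normr0. Qed.

Lemma rnorm_eq0 (W : normedZmodType R[i]) (x : W) : rnorm x = 0 -> x = 0.
Proof. by move=> x0; apply/eqP; rewrite -normr_eq0 -rnormE x0. Qed.

Lemma rnorm_gt0 (W : normedZmodType R[i]) (x : W) : x <> 0 -> 0 < rnorm x.
Proof.
by move=> x0; rewrite lt_neqAle rnorm_ge0 andbT eq_sym; apply/eqP => /rnorm_eq0.
Qed.

Lemma rnormN x : rnorm (- x) = rnorm x.
Proof. by rewrite /rnorm normrN. Qed.

Lemma rdistC x y : rnorm (x - y) = rnorm (y - x).
Proof. by rewrite /rnorm distrC. Qed.

Lemma rnormD x y : rnorm (x + y) <= rnorm x + rnorm y.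
Proof. by rewrite -lecR rmorphD /= !rnormE ler_normD. Qed.

Lemma rnormZ a x : rnorm (a *: x) = rnorm a * rnorm x.
Proof.
by apply: (@complexI R); rewrite rmorphM /= !rnormE normrZ.
Qed.

Lemma rnorm_sum (I : Type) (s : seq I) (P : pred I) (F : I -> V) :
  rnorm (\sum_(i <- s | P i) F i) <= \sum_(i <- s | P i) rnorm (F i).
Proof.
elim/big_ind2: _ => [|x1 x2 y1 y2 h1 h2|//]; first by rewrite rnorm0.
by rewrite (le_trans (rnormD _ _)) ?lerD.
Qed.

Lemma rnorm_le_eps x : (forall e, 0 < e -> rnorm x <= e) -> x = 0.
Proof.
move=> h; apply: rnorm_eq0; apply/eqP; rewrite eq_le rnorm_ge0 andbT.
by apply/ler_addgt0Pr => e e0; rewrite add0r h.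
Qed.

Lemma ball_rnorm x y (e : R) : ball x e%:C y <-> rnorm (x - y) < e.
Proof. by rewrite -ball_normE /= -rnormE ltcR. Qed.

Lemma complex_gt0P (e : R[i]) : 0 < e -> exists2 r : R, 0 < r & e = r%:C.
Proof.
move=> e0; exists (complex.Re e); last by rewrite RRe_real // gtr0_real.
by rewrite -ltcR RRe_real // gtr0_real.
Qed.

Lemma denseP (D : set V) :
  dense D <-> forall x (e : R), 0 < e -> exists2 y, D y & rnorm (x - y) < e.
Proof.
split=> [dD x e e0|hD O [x Ox] oO].
  have e0' : 0 < e%:C by rewrite ltcR.
  have [||y [yx Dy]] := dD (ball x e%:C)°.
  - by exists x; exact: (nbhsx_ballx x _ e0').
  - exact: open_interior.
  - by exists y => //; apply/ball_rnorm; exact: interior_subset yx.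
have /nbhs_ballP[e /= e0 xO] : nbhs x O by apply: open_nbhs_nbhs.
have [r r0 er] := complex_gt0P e0.
have [y Dy xy] := hD x _ r0; exists y; split=> //; apply: xO.
by rewrite er ball_rnorm.
Qed.

Lemma closedP (A : set V) :
  closed A <->
  forall x, (forall e : R, 0 < e -> exists2 y, A y & rnorm (x - y) < e) -> A x.
Proof.
split=> [cA x hx|hA x xA].
  apply: cA => B /nbhs_ballP[e /= e0 xB].
  have [r r0 er] := complex_gt0P e0; have [y Ay xy] := hx _ r0.
  by exists y; split=> //; apply: xB; rewrite er ball_rnorm.
apply: hA => e e0; have e0' : 0 < e%:C by rewrite ltcR.
have [y [Ay /ball_rnorm xy]] := xA _ (nbhsx_ballx x _ e0').
by exists y.
Qed.

Definition seq_lim (f : nat -> V) (z : V) : Prop :=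
  forall e : R, 0 < e -> exists K, forall k, (K <= k)%N -> rnorm (f k - z) < e.

Lemma cvg_seq_lim (f : nat -> V) z : f k @[k --> \oo] --> z -> seq_lim f z.
Proof.
move=> /cvgrPdist_lt fz e e0.
have e0' : 0 < e%:C by rewrite ltcR.
have [K _ hK] := fz _ e0'.
by exists K => k Kk; rewrite -ltcR rnormE distrC; apply: hK.
Qed.

Lemma seq_limP (f : nat -> V) a z1 (g : nat -> V) z2 :
  seq_lim f z1 -> seq_lim g z2 ->
  seq_lim (fun k => a *: f k + g k) (a *: z1 + z2).
Proof.
move=> f1 g2 e e0; have a0 := rnorm_ge0 a.
have e1 : 0 < e / 2 / (rnorm a + 1) by rewrite !divr_gt0 // ltr_wpDl.
have e2 : 0 < e / 2 by rewrite divr_gt0.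
have [K1 h1] := f1 _ e1; have [K2 h2] := g2 _ e2.
exists (maxn K1 K2) => k; rewrite geq_max => /andP[/h1 k1 /h2 k2].
rewrite opprD addrACA -scalerBr (le_lt_trans (rnormD _ _)) // rnormZ.
have : rnorm a * rnorm (f k - z1) <= (rnorm a + 1) * (e / 2 / (rnorm a + 1)).
  by rewrite ler_pM ?rnorm_ge0 ?lerDl // ltW.
rewrite mulrCA divff ?mulr1; last by rewrite gt_eqF // ltr_wpDl.
lra.
Qed.

Lemma seq_lim_le (f : nat -> V) z x (c : R) K :
  seq_lim f z -> (forall k, (K <= k)%N -> rnorm (f k - x) <= c) ->
  rnorm (z - x) <= c.
Proof.
move=> fz fc; apply/ler_addgt0Pr => e e0.
have [K' /(_ (maxn K K') (leq_maxr _ _)) h] := fz _ e0.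
have := fc _ (leq_maxl K K'); have := rnormD (z - f (maxn K K')) (f (maxn K K') - x).
by rewrite subrKA rdistC; lra.
Qed.
End RealNorm.

Lemma cauchy_seq_lim (R : realType) (V : completeNormedModType R[i])
  (f : nat -> V) :
  (forall e : R, 0 < e ->
     exists K, forall k l, (K <= k)%N -> (K <= l)%N -> rnorm (f k - f l) < e) ->
  exists z, seq_lim f z.
Proof.
move=> fC; suff fcvg : cvg (f k @[k --> \oo]).
  by exists (lim (f k @[k --> \oo])); apply: cvg_seq_lim.
apply: cauchy_cvg; apply/cauchy_exP => _ /complex_gt0P[e e0 ->].
have [K hK] := fC _ e0; exists (f K), K => // k Kk.
by apply/ball_rnorm/hK => //=.
Qed.

Lemma cauchy_seq_lim_tail (R : realType) (V : completeNormedModType R[i])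
  (f : nat -> V) (b : nat -> R) :
  (forall e : R, 0 < e -> exists K, b K < e) ->
  (forall k l, (k <= l)%N -> rnorm (f l - f k) <= b k) ->
  exists z, seq_lim f z.
Proof.
move=> b0 fb; apply: cauchy_seq_lim => e e0.
have e2 : 0 < e / 2 by rewrite divr_gt0.
have [K bK] := b0 _ e2; exists K => k l Kk Kl.
rewrite -(subrKA (f K)) (le_lt_trans (rnormD _ _)) // rdistC (rdistC (f K)).
by have := fb _ _ Kk; have := fb _ _ Kl; rewrite (rdistC (f l)) (rdistC (f k)); lra.
Qed.

(** * Dependent choice and geometric sums *)

(** Dependent choice in which a new term may depend on the whole finite history; only histories
    built correctly so far have to be extended. *)
Lemma history_choice (T : Type) (t0 : T) (P : seq T -> T -> Prop) :
  (forall s, (forall i, (i < size s)%N -> P (take i s) (nth t0 s i)) ->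
     exists t, P s t) ->
  exists f : nat -> T, forall i, P (mkseq f i) (f i).
Proof.
move=> hP; pose good s := forall i, (i < size s)%N -> P (take i s) (nth t0 s i).
have /choice[g gP] : forall s, exists t, good s -> P s t.
  by move=> s; have [/hP[t st]|] := pselect (good s); [exists t|exists t0].
(* [chain n] lists the first [n] terms. Strong induction shows that each of these prefixes is good,
   so [g] extends it correctly. *)
pose chain n := iter n (fun s => rcons s (g s)) [::].
have chainE i : mkseq (g \o chain) i = chain i.
  by elim: i => // i IH; rewrite mkseqS IH.
exists (g \o chain); elim/ltn_ind => i IH.
rewrite chainE; apply: gP => j; rewrite -chainE size_mkseq => ji.
rewrite nth_mkseq // /mkseq -map_take take_iota (minn_idPl (ltnW ji)).
exact: IH.
Qed.

(** Orthonormal sequences and the stages of the perturbation are both built from conditions on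
    single terms ([G]) and on pairs of terms ([B]). *)
Lemma pairwise_choice (T : Type) (t0 : T) (G : nat -> T -> Prop)
    (B : nat -> nat -> T -> T -> Prop) :
  (forall s,
     (forall i, (i < size s)%N -> G i (nth t0 s i)) ->
     (forall p i, (p < i < size s)%N -> B p i (nth t0 s p) (nth t0 s i)) ->
     exists t, G (size s) t /\
       forall p, (p < size s)%N -> B p (size s) (nth t0 s p) t) ->
  exists f : nat -> T,
    (forall i, G i (f i)) /\ forall p i, (p < i)%N -> B p i (f p) (f i).
Proof.
move=> h; have [|f fP] := @history_choice T t0 (fun s t => G (size s) t /\
    forall p, (p < size s)%N -> B p (size s) (nth t0 s p) t).
  move=> s hs; apply: h => [i si|p i /andP[pi si]].
    by have [] := hs i si; rewrite size_takel ?(ltnW si).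
  by have [_ /(_ p)] := hs i si; rewrite size_takel ?(ltnW si) // nth_take //; apply.
exists f; split=> [i|p i pi]; have := fP i; rewrite size_mkseq => -[//].
by move=> _ /(_ p pi); rewrite nth_mkseq.
Qed.

Lemma sum_half_le (R : realType) (m M : nat) :
  \sum_(m <= j < M) (2^-1 : R) ^+ j <= 2 * 2^-1 ^+ m.
Proof.
have h0 n : 0 < (2^-1 : R) ^+ n by rewrite exprn_gt0.
have [mM|Mm] := leqP m M; last by rewrite big_geq ?mulr_ge0 // ltnW.
suff -> : \sum_(m <= j < M) (2^-1 : R) ^+ j = 2 * 2^-1 ^+ m - 2 * 2^-1 ^+ M.
  by have := h0 M; lra.
rewrite -(subnKC mM); elim: (M - m)%N => [|k IH].
  by rewrite addn0 big_geq ?subrr.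
by rewrite addnS big_nat_recr ?leq_addr //= IH exprS; lra.
Qed.

Lemma half_lt (R : realType) (e : R) : 0 < e ->
  exists K, forall k, (K <= k)%N -> (2^-1 : R) ^+ k < e.
Proof.
move=> e0; have /cvgrPdist_lt/(_ _ e0)[K _ hK] :
    (2^-1 : R) ^+ k @[k --> \oo] --> (0 : R).
  by apply: cvg_expr; rewrite ger0_norm // invf_lt1 // ltr1n.
by exists K => k /hK; rewrite sub0r normrN ger0_norm // exprn_ge0.
Qed.

(** * Linear subspaces given as sets *)

Section Submodules.
Variables (R : realType) (V : normedModType R[i]) (A : set V).

Lemma submod_closedP :
  submod_closed [in A] <->
  A 0 /\ forall a x y, A x -> A y -> A (a *: x + y).
Proof.
split=> -[A0 Al]; split.
- by move: A0; rewrite in_setE.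
- by move=> a x y Ax Ay; have := Al a x y; rewrite !in_setE; apply.
- by rewrite in_setE.
- by move=> a x y; rewrite !in_setE; apply: Al.
Qed.

Hypothesis Asub : submod_closed [in A].

Lemma submodZ a x : A x -> A (a *: x).
Proof.
by move=> Ax; have [A0 /(_ a x 0 Ax A0)] := submod_closedP.1 Asub; rewrite addr0.
Qed.

Lemma submodD x y : A x -> A y -> A (x + y).
Proof.
by move=> Ax Ay; have [_ /(_ 1 x y Ax Ay)] := submod_closedP.1 Asub; rewrite scale1r.
Qed.

Lemma submod_sum (I : Type) (s : seq I) (P : pred I) (F : I -> V) :
  (forall i, P i -> A (F i)) -> A (\sum_(i <- s | P i) F i).
Proof.
move=> AF; apply: big_ind => //; last exact: submodD.
by have [] := submod_closedP.1 Asub.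
Qed.

End Submodules.

(** * Orthonormal sequences *)

Section Orthonormal.
Variables (R : realType) (H : completeNormedModType R[i]).
Variables (ip : {dot H for Num.conj}) (ip_norm : norm_from_dot ip).

Definition orthonormal_seq (e : nat -> H) : Prop :=
  forall i j, ip (e i) (e j) = (i == j)%:R.

Lemma ip_sym0 x y : ip x y = 0 -> ip y x = 0.
Proof. by move=> xy; rewrite (hermC ip) /= xy rmorph0 mulr0. Qed.

(** Pythagoras: the squared norms of orthogonal vectors add up. *)
Lemma rnorm_le_orthoD p q : ip q p = 0 -> rnorm p <= rnorm (q + p).
Proof.
move=> qp; rewrite le_rnorm -ler_sqr ?nnegrE ?normr_ge0 // !ip_norm.
by rewrite dnormD qp rmorph0 !addr0 lerDr dnorm_ge0.
Qed.

Lemma ipBl x y z : ip (x - y) z = ip x z - ip y z.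
Proof. exact: linearBl. Qed.

Lemma ip_suml (I : Type) (s : seq I) (P : pred I) (c : I -> R[i]) (F : I -> H) z :
  ip (\sum_(i <- s | P i) c i *: F i) z = \sum_(i <- s | P i) c i * ip (F i) z.
Proof.
rewrite linear_sumlz; apply: eq_bigr => i _; exact: linearZl_LR.
Qed.

Lemma ip_sumr (I : Type) (s : seq I) (P : pred I) (c : I -> R[i]) (F : I -> H) z :
  (forall i, P i -> ip z (F i) = 0) ->
  ip z (\sum_(i <- s | P i) c i *: F i) = 0.
Proof.
move=> zF; rewrite linear_sumr big1 // => i Pi.
by rewrite linearZr_LR /= zF // mulr0.
Qed.

Lemma rnorm_unit x : ip x x = 1 -> rnorm x = 1.
Proof.
move=> x1; apply: (@complexI R); rewrite rnormE; apply/eqP.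
by rewrite -(@eqrXn2 _ 2) ?normr_ge0 // ip_norm x1 expr1n.
Qed.

(** Gram-Schmidt. Infinite dimension provides at each step a vector outside the span of the finite
    family [s]; removing its projection on that span leaves a nonzero [w] to normalise. *)
Lemma exists_orthonormal (A : set H) :
  submod_closed [in A] -> infinite_dimensional A ->
  exists2 e, orthonormal_seq e & forall i, A (e i).
Proof.
move=> As Ainf.
have [|e [eA eo]] := @pairwise_choice H 0 (fun _ x => A x /\ ip x x = 1)
    (fun _ _ x y => ip x y = 0).
  move=> s sA so.
  have ip_s i j : (i < size s)%N -> (j < size s)%N ->
      ip s`_i s`_j = (i == j)%:R.
    move=> si sj; have [ij|ji|->] := ltngtP i j.
    - by apply: so; rewrite ij.
    - by apply: ip_sym0; apply: so; rewrite ji.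
    - by have [] := sA _ sj.
  have [x Ax xs] : exists2 x, A x &
      forall a : 'I_(size s) -> R[i], x <> \sum_(i < size s) a i *: s`_i.
    apply: contrapT => hx; apply: Ainf; exists (size s), (fun i => s`_i).
    split=> [i|x Ax]; first by have [] := sA _ (ltn_ord i).
    apply: contrapT => xs; apply: hx; exists x => // a xa.
    by apply: xs; exists a.
  pose w := x - \sum_(i < size s) ip x s`_i *: s`_i.
  have Aw : A w.
    rewrite /w addrC -scaleN1r; apply: ((submod_closedP A).1 As).2 => //.
    by apply: submod_sum => // i _; apply: submodZ => //; have [] := sA _ (ltn_ord i).
  have ws j : (j < size s)%N -> ip w s`_j = 0.
    move=> sj; rewrite ipBl ip_suml (bigD1 (Ordinal sj)) //= ip_s // eqxx mulr1.
    rewrite big1 ?addr0 ?subrr // => i /eqP ij; rewrite ip_s //.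
    by case: eqP => [ij'|_]; [case: ij; apply: val_inj | rewrite mulr0].
  have w0 : `|w| != 0.
    rewrite normr_eq0; apply/eqP => /eqP; rewrite subr_eq0 => /eqP.
    exact: xs.
  exists (`|w|^-1 *: w); split; first split.
  - exact: submodZ.
  - rewrite dnormZ -ip_norm normfV normr_id -exprMn mulVf ?expr1n //.
  - move=> p sp; apply: ip_sym0.
    by rewrite linearZl_LR /= ws // mulr0.
exists e => [i j|i]; last by have [] := eA i.
have [ij|ji|->] := ltngtP i j.
- exact: eo.
- by apply: ip_sym0; apply: eo.
- by have [] := eA j.
Qed.

Variables (e : nat -> H) (e_on : orthonormal_seq e).

Definition oproj (J : nat) (x : H) : H := \sum_(0 <= j < J) ip x (e j) *: e j.

(** The closed linear span of [e], described as the vectors recovered by their Fourier expansion.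
    Membership directly gives the vanishing tails used in the estimates. *)
Definition ospan : set H := [set x | seq_lim (oproj^~ x) x].

Lemma rnorm_onb j : rnorm (e j) = 1.
Proof. by rewrite rnorm_unit // e_on eqxx. Qed.

Lemma rnorm_coef x j : rnorm (ip x (e j)) <= rnorm x.
Proof.
have -> : rnorm (ip x (e j)) = rnorm (ip x (e j) *: e j).
  by rewrite rnormZ rnorm_onb mulr1.
rewrite -[leRHS](congr1 (@rnorm R H) (subrK (ip x (e j) *: e j) x)).
apply: rnorm_le_orthoD; rewrite ipBl linearZr_LR /= linearZl_LR /=.
by rewrite linearZr_LR /= e_on eqxx mulr1 [X in X - _]mulrC subrr.
Qed.

Lemma ip_oproj J x j : (j < J)%N -> ip (oproj J x) (e j) = ip x (e j).
Proof.
move=> jJ; rewrite ip_suml (bigD1_seq j) ?mem_index_iota ?iota_uniq //=.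
rewrite e_on eqxx mulr1 big1 ?addr0 // => i /negbTE ij.
by rewrite e_on ij mulr0.
Qed.

(** Bessel's inequality: [x - oproj J x] is orthogonal to each [e j] with [j < J], hence to the
    projection. *)
Lemma rnorm_oproj J x : rnorm (oproj J x) <= rnorm x.
Proof.
rewrite -[leRHS](congr1 (@rnorm R H) (subrK (oproj J x) x)).
apply: rnorm_le_orthoD; rewrite {2}/oproj big_nat.
by apply: ip_sumr => j /andP[_ jJ]; rewrite ipBl ip_oproj // subrr.
Qed.

Lemma oprojP J a x y : oproj J (a *: x + y) = a *: oproj J x + oproj J y.
Proof.
rewrite /oproj scaler_sumr -big_split /=; apply: eq_bigr => j _.
by rewrite scalerA -scalerDl linearPl.
Qed.

Lemma oprojB J x y : oproj J (x - y) = oproj J x - oproj J y.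
Proof. by rewrite addrC -scaleN1r oprojP scaleN1r addrC. Qed.

Lemma oproj_onb J i : (i < J)%N -> oproj J (e i) = e i.
Proof.
move=> iJ; rewrite /oproj (bigD1_seq i) ?mem_index_iota ?iota_uniq //=.
rewrite e_on eqxx scale1r big1 ?addr0 // => j /negbTE ij.
by rewrite e_on eq_sym ij scale0r.
Qed.

Lemma ospan_onb i : ospan (e i).
Proof.
move=> eps eps0; exists i.+1 => k ik.
by rewrite oproj_onb // subrr rnorm0.
Qed.

Lemma ospan_submod : submod_closed [in ospan].
Proof.
apply/submod_closedP; split.
  move=> eps eps0; exists 0%N => k _; rewrite subr0.
  by rewrite (le_lt_trans (rnorm_oproj _ _)) // rnorm0.
move=> a x y hx hy; rewrite /ospan /=.
have := seq_limP a hx hy; congr seq_lim.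
by apply/funext => J; rewrite oprojP.
Qed.

(** The projections are contractions uniformly in [J], so convergence at a nearby [y] passes to [x]
    with three errors below [eps / 3]. *)
Lemma ospan_closed : closed ospan.
Proof.
apply/closedP => x xA eps eps0; have e3 : 0 < eps / 3 by rewrite divr_gt0.
have [y Ay xy] := xA _ e3; have [K hK] := Ay _ e3.
exists K => k /hK yk; rewrite -(subrKA (oproj k y)) -oprojB.
rewrite (le_lt_trans (rnormD _ _)) //.
have := rnormD (oproj k y - y) (y - x); have := rnorm_oproj k (x - y).
by rewrite subrKA (rdistC y); lra.
Qed.

Lemma ospan_sub (A : set H) :
  submod_closed [in A] -> closed A -> (forall i, A (e i)) -> ospan `<=` A.
Proof.
move=> As /closedP Ac eA x hx; apply: Ac => eps /hx[K hK].
exists (oproj K x); last by rewrite rdistC hK.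
by apply: submod_sum => // i _; apply: submodZ.
Qed.

Lemma ospan_eq0 x : ospan x -> (forall j, ip x (e j) = 0) -> x = 0.
Proof.
move=> hx x0; rewrite -[x]opprK -[RHS]oppr0; congr (- _).
apply: rnorm_le_eps => eps /hx[K /(_ K (leqnn K))].
by rewrite /oproj big1 ?sub0r => [/ltW//|j _]; rewrite x0 scale0r.
Qed.

End Orthonormal.

(** * Uniform boundedness *)

Section BoundedFamily.
Variables (R : realType) (H : completeNormedModType R[i]).

Definition bounded_linear (f : H -> H) : Prop :=
  exists2 D : R, 0 < D & forall x, rnorm (f x) <= D * rnorm x.

Lemma bounded_linear_small (f : H -> H) (eps : R) :
  bounded_linear f -> 0 < eps ->
  exists2 d, 0 < d & forall x, rnorm x <= d -> rnorm (f x) <= eps.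
Proof.
move=> [D D0 fD] eps0; exists (eps / D) => [|x xd]; first by rewrite divr_gt0.
by rewrite (le_trans (fD x)) // mulrC -ler_pdivlMr.
Qed.

Lemma bounded_linear_lim (f : {linear H -> H}) (u : nat -> H) z :
  bounded_linear f -> seq_lim u z -> seq_lim (f \o u) (f z).
Proof.
move=> [D D0 fD] uz eps eps0.
have [K hK] := uz _ (divr_gt0 eps0 D0); exists K => k /hK uk.
by rewrite /= -linearB (le_lt_trans (fD _)) // mulrC -ltr_pdivlMr.
Qed.

Variables (L : nat -> {linear H -> H}) (Lbnd : forall k, bounded_linear (L k)).

Lemma small_ball (ks : seq nat) (eps : R) : 0 < eps ->
  exists d, [/\ 0 < d, d <= eps &
    forall k x, k \in ks -> rnorm x <= d -> rnorm (L k x) <= eps].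
Proof.
move=> eps0; elim: ks => [|k ks [d [d0 deps hd]]].
  by exists eps; split.
have [d' d'0 hd'] := bounded_linear_small (Lbnd k) eps0.
exists (Num.min d d'); split; first by rewrite lt_min d0.
  by rewrite ge_min deps.
move=> k' x; rewrite inE le_min => /orP[/eqP->|k'ks] /andP[xd xd'].
  exact: hd'.
exact: hd.
Qed.

Lemma scale_to (x : H) (d : R) : x <> 0 -> 0 < d ->
  rnorm ((d / rnorm x)%:C *: x) = d /\ rnorm ((d / rnorm x)%:C : R[i]) = d / rnorm x.
Proof.
move=> x0 d0; have rx := rnorm_gt0 x0.
have E : rnorm ((d / rnorm x)%:C : R[i]) = d / rnorm x.
  apply: (@complexI R); rewrite rnormE ger0_norm // lecR ltW // divr_gt0 //.
by split; rewrite // rnormZ E divfK // gt_eqF.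
Qed.

(* Gliding hump: if the restrictions of the [L k] to [A] were unbounded in
   norm, a convergent series of small steps in [A] would reach a point at which
   the [L k] are unbounded; the sign of a step is chosen so that it does not
   cancel against the previous ones. *)
Lemma uniform_boundedness (A : set H) :
  submod_closed [in A] -> closed A ->
  (forall z, A z -> exists C : R, forall k, rnorm (L k z) <= C) ->
  exists C : R, forall k z, A z -> rnorm (L k z) <= C * rnorm z.
Proof.
move=> As /closedP Ac Abnd; apply: contrapT => nb.
have big C : 0 <= C -> exists k z, A z /\ C * rnorm z < rnorm (L k z).
  move=> C0; apply: contrapT => nk; apply: nb; exists C => k z Az.
  by rewrite leNgt; apply/negP => Cz; apply: nk; exists k, z.
(* A term pairs an operator index with a step. The third clause keeps the new step small under the
   operators chosen before, so that it cannot undo the growth which the fourth clause secures. *)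
pose P (s : seq (nat * H)) (t : nat * H) := [/\ A t.2,
  rnorm t.2 <= 2^-1 ^+ size s,
  forall p, p \in map fst s -> rnorm (L p t.2) <= 2^-1 ^+ size s &
  (size s)%:R <= rnorm (L t.1 (\sum_(p <- s) p.2 + t.2))].
have [|f fP] := @history_choice _ (0%N, 0) P.
  move=> s _; have half0 : 0 < (2^-1 : R) ^+ size s by rewrite exprn_gt0.
  have [d [d0 deps hd]] := small_ball (map fst s) half0.
  (* With this [C], rescaling [z] to norm [d] gives a vector whose image exceeds [size s + 1]. *)
  pose C := ((size s)%:R + 1) / d.
  have C0 : 0 <= C by rewrite divr_ge0 ?addr_ge0 // ltW.
  have [k [z [Az zC]]] := big _ C0.
  have z0 : z <> 0 by move=> z0; move: zC; rewrite z0 linear0 rnorm0 mulr0 ltxx.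
  pose v := (d / rnorm z)%:C *: z.
  have [vd rd] := scale_to z0 d0.
  have vC : (size s)%:R < rnorm (L k v).
    have rz := rnorm_gt0 z0; rewrite /v linearZ rnormZ rd.
    have : d / rnorm z * (C * rnorm z) < d / rnorm z * rnorm (L k z).
      by rewrite ltr_pM2l // divr_gt0.
    have -> : d / rnorm z * (C * rnorm z) = (size s)%:R + 1.
      by rewrite /C; field; rewrite !gt_eqF.
    lra.
  pose S := \sum_(p <- s) p.2.
  have AV (b : bool) : A ((-1) ^+ b *: v) by apply: (submodZ As); apply: (submodZ As).
  have rV (b : bool) : rnorm ((-1) ^+ b *: v : H) = d.
    by case: b; rewrite /= ?expr1 ?expr0 ?scaleN1r ?scale1r ?rnormN; exact: vd.
  have [b bS] : exists b : bool, (size s)%:R <= rnorm (L k (S + (-1) ^+ b *: v)).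
    have [Sv|Sv] := leP (size s)%:R (rnorm (L k (S + v))).
      by exists false; rewrite expr0 scale1r.
    exists true; rewrite expr1 scaleN1r.
    (* The images of [S + v] and [S - v] differ by [2 *: L k v], of norm above [2 * size s], so one
       of the two has norm at least [size s]. *)
    have := rnormD (L k (S + v)) (- L k (S - v)).
    rewrite -linearB opprB addrC subrKA rnormN.
    have -> : v + v = 2 *: v by rewrite scaler_nat mulr2n.
    rewrite linearZ rnormZ.
    have -> : rnorm (2 : R[i]) = 2.
      by apply: (@complexI R); rewrite rnormE normr_nat rmorph_nat.
    lra.
  exists (k, (-1) ^+ b *: v); split => //=.
  - by rewrite rV.
  - by move=> p ps; rewrite hd // rV.
pose x n := \sum_(0 <= i < n) (f i).2.
have fA i : A (f i).2 by have [] := fP i.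
have fS i : rnorm (f i).2 <= 2^-1 ^+ i.
  by have [_] := fP i; rewrite size_mkseq.
have fL i : i%:R <= rnorm (L (f i).1 (x i.+1)).
  have [_ _ _] := fP i; rewrite size_mkseq /x big_nat_recr //=.
  by rewrite /mkseq big_map /index_iota subn0.
have xB k l : (k <= l)%N -> x l - x k = \sum_(k <= i < l) (f i).2.
  by move=> kl; rewrite /x (big_cat_nat (leq0n k) kl) addrC addKr.
have [|k l kl|z xz] := @cauchy_seq_lim_tail _ _ x (fun k => 2 * 2^-1 ^+ k).
- move=> e e0; have e2 : 0 < e / 2 by rewrite divr_gt0.
  have [K /(_ K (leqnn K)) hK] := half_lt e2; exists K; lra.
- rewrite xB // (le_trans (rnorm_sum _ _ _)) //.
  by rewrite (le_trans _ (sum_half_le R k l)) // ler_sum.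
have Az : A z.
  apply: Ac => e /xz[K /(_ K (leqnn K)) hK].
  by exists (x K); [apply: submod_sum | rewrite rdistC].
have [C Cz] := Abnd z Az.
(* The steps after [n] contribute at most [2] under the operator of stage [n], so its value at [z]
   has norm at least [n - 2], which exceeds [C]. *)
pose n := (Num.truncn (C + 2)).+1.
have nC : C + 2 < n%:R by exact: truncnS_gt.
have := seq_lim_le (x := L (f n).1 (x n.+1)) (c := 2)
   (bounded_linear_lim (Lbnd (f n).1) xz).
move=> /(_ n.+1) h.
have {h} : rnorm (L (f n).1 z - L (f n).1 (x n.+1)) <= 2.
  apply: h => k nk; rewrite /= -linearB xB // linear_sum.
  rewrite (le_trans (rnorm_sum _ _ _)) //.
  apply: (@le_trans _ _ (\sum_(n.+1 <= i < k) 2^-1 ^+ i)).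
    apply: ler_sum_nat => i /andP[ni ik].
    have [_ _ + _] := fP i; rewrite size_mkseq; apply.
    by apply: map_f; apply: map_f; rewrite mem_iota.
  rewrite (le_trans (sum_half_le R _ _)) // ler_piMr //.
  by rewrite exprn_ile1 ?invf_le1 ?ler1n.
have := rnormD (L (f n).1 z) (- (L (f n).1 z - L (f n).1 (x n.+1))).
rewrite opprB addrC subrK rdistC; have := fL n; have := Cz (f n).1; lra.
Qed.

Lemma eventually_small (X : set H) (xs : seq H) (eps : R) :
  (forall x, X x -> seq_lim (fun k => L k x) 0) ->
  (forall x, x \in xs -> X x) -> 0 < eps ->
  exists K, forall k x, (K <= k)%N -> x \in xs -> rnorm (L k x) <= eps.
Proof.
move=> LX; elim: xs => [|x xs IH] xsX eps0; first by exists 0%N.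
have [|K hK] := IH _ eps0; first by move=> y ys; apply: xsX; rewrite inE ys orbT.
have [K' hK'] := LX x (xsX _ (mem_head _ _)) _ eps0.
exists (maxn K K') => k y; rewrite geq_max inE => /andP[Kk /hK' xk] /orP[/eqP->|].
  by move: xk; rewrite subr0 => /ltW.
exact: hK.
Qed.

End BoundedFamily.

(** * Perturbations of the identity *)

(** The term of rank [i] is decoded from the 2-adic valuation of [i + 1]. For a code [c], the number
    [2 ^ c * (2 * K + 1)] has valuation [c] and exceeds [K]. *)
Lemma exists_recurrent (T : countType) (t0 : T) :
  exists s : nat -> T, forall t K, exists2 i, (K <= i)%N & s i = t.
Proof.
exists (fun i => odflt t0 (unpickle (logn 2 i.+1))) => t K.
pose c := pickle t; have pos : (0 < 2 ^ c * K.*2.+1)%N by rewrite muln_gt0 expn_gt0.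
exists (2 ^ c * K.*2.+1).-1.
  rewrite -ltnS prednK // (leq_trans _ (leq_pmull _ _)) ?expn_gt0 //.
  by rewrite ltnS -addnn leq_addr.
rewrite prednK // lognM ?expn_gt0 // pfactorK //.
rewrite (@logn_coprime 2 K.*2.+1) ?addn0 ?pickleK //.
by rewrite coprime2n /= odd_double.
Qed.

(** If [n] vectors spanned [M], the coordinates of [n + 1] terms of [f] would form a matrix with
    [n + 1] rows and [n] columns; a nonzero vector of its left kernel is a forbidden relation. *)
Lemma infinite_dimensional_free (R : realType) (H : completeNormedModType R[i])
    (M : set H) (f : nat -> H) :
  (forall j, M (f j)) ->
  (forall n (a : 'I_n -> R[i]), \sum_(j < n) a j *: f j = 0 -> forall j, a j = 0) ->
  infinite_dimensional M.
Proof.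
move=> Mf free [n [v [Mv span]]].
have /choice[A fA] : forall j, exists a : 'I_n -> R[i], f j = \sum_(i < n) a i *: v i.
  by move=> j; apply: span.
pose B : 'M[R[i]]_(n.+1, n) := \matrix_(j, i) A j i.
have : kermx B != 0.
  by rewrite kermx_eq0 /row_free ltn_eqF // ltnS rank_leq_col.
move=> /rowV0Pn[c /sub_kermxP cB /eqP[]].
apply/rowP => j; rewrite mxE.
apply: (free _ (fun j => c 0 j)); clear j.
under eq_bigr do rewrite fA scaler_sumr.
rewrite exchange_big big1 //= => i _.
have := congr1 (fun r : 'rV_n => r 0 i) cB; rewrite !mxE => cBi.
under eq_bigr do rewrite scalerA.
rewrite -scaler_suml -[RHS](scale0r (v i)) -[in RHS]cBi; congr (_ *: _).
by apply: eq_bigr => j _; rewrite mxE.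
Qed.

Section Perturbation.
Variables (R : realType) (H : completeNormedModType R[i]).
Variables (ip : {dot H for Num.conj}) (ip_norm : norm_from_dot ip).
Variables (e : nat -> H) (e_on : orthonormal_seq ip e).
Variables (m : nat -> nat) (u d : nat -> H).

Definition pert (p : nat) (x : H) : H :=
  ip x (e p) *: d p + ip x (e (m p)) *: u p.

Definition pertI (N : nat) (x : H) : H := x + \sum_(0 <= p < N) pert p x.

Lemma pertP p a x y : pert p (a *: x + y) = a *: pert p x + pert p y.
Proof.
by rewrite /pert !linearPl /= !scalerDl scalerDr !scalerA addrACA.
Qed.

Lemma pertIP N a x y : pertI N (a *: x + y) = a *: pertI N x + pertI N y.
Proof.
rewrite /pertI scalerDr addrACA scaler_sumr -big_split /=; congr (_ + _).
by apply: eq_bigr => p _; rewrite pertP.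
Qed.

(** The perturbed identity, kept as the graph of a limit: linearity is inherited from the partial
    sums, and existence of the limit is a separate matter. *)
Definition pert_graph (x z : H) : Prop := seq_lim (pertI^~ x) z.

Lemma pert_graphP a x y z w :
  pert_graph x z -> pert_graph y w -> pert_graph (a *: x + y) (a *: z + w).
Proof.
move=> xz yw; have := seq_limP a xz yw; congr seq_lim.
by apply/funext => N; rewrite pertIP.
Qed.

Lemma pert_graph0 : pert_graph 0 0.
Proof.
move=> eps eps0; exists 0%N => k _; rewrite /pertI add0r subr0 big1 ?rnorm0 //.
by move=> p _; rewrite /pert !linear0l !scale0r addr0.
Qed.

Lemma pert_graphB x y z w :
  pert_graph x z -> pert_graph y w -> pert_graph (x - y) (z - w).
Proof.
move=> xz yw; rewrite addrC [z - w]addrC -(scaleN1r y) -(scaleN1r w).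
exact: pert_graphP.
Qed.

Lemma pert_graph_sum n (a : 'I_n -> R[i]) (x z : 'I_n -> H) :
  (forall j, pert_graph (x j) (z j)) ->
  pert_graph (\sum_(j < n) a j *: x j) (\sum_(j < n) a j *: z j).
Proof.
move=> xz; apply: (big_ind2 pert_graph); first exact: pert_graph0.
  move=> x1 z1 x2 z2 h1 h2; have := pert_graphP 1 h1 h2.
  by rewrite !scale1r.
move=> j _; have := pert_graphP (a j) (xz j) pert_graph0.
by rewrite !addr0.
Qed.

Hypothesis u_small : forall p, rnorm (u p) <= 8^-1 * 2^-1 ^+ p.
Hypothesis d_small : forall p, rnorm (d p) <= 8^-1 * 2^-1 ^+ p.

Lemma rnorm_pert p x : rnorm (pert p x) <= 4^-1 * rnorm x * 2^-1 ^+ p.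
Proof.
have xp : rnorm (ip x (e p) *: d p) <= rnorm x * (8^-1 * 2^-1 ^+ p).
  by rewrite rnormZ ler_pM ?rnorm_ge0 // rnorm_coef.
have xm : rnorm (ip x (e (m p)) *: u p) <= rnorm x * (8^-1 * 2^-1 ^+ p).
  by rewrite rnormZ ler_pM ?rnorm_ge0 // rnorm_coef.
by rewrite (le_trans (rnormD _ _)) //; lra.
Qed.

(** Two terms with constant [1/8] and the factor [2] of the geometric tail give [1/2], a
    perturbation small enough for the map to be bounded below. *)
Lemma rnorm_pert_sum k l x :
  rnorm (\sum_(k <= p < l) pert p x) <= rnorm x / 2 * 2^-1 ^+ k.
Proof.
rewrite (le_trans (rnorm_sum _ _ _)) //.
apply: (@le_trans _ _ (\sum_(k <= p < l) 4^-1 * rnorm x * 2^-1 ^+ p)).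
  by apply: ler_sum => p _; apply: rnorm_pert.
rewrite -mulr_sumr.
have := ler_wpM2l (mulr_ge0 (_ : 0 <= (4^-1 : R)) (rnorm_ge0 x)) (sum_half_le R k l).
by rewrite invr_ge0 ler0n => /(_ isT); lra.
Qed.

Lemma pert_graph_dist x z : pert_graph x z -> rnorm (z - x) <= rnorm x / 2.
Proof.
move=> xz; apply: (seq_lim_le (K := 0%N) xz) => N _.
rewrite /pertI addrC addKr.
by have := rnorm_pert_sum 0 N x; rewrite expr0 mulr1.
Qed.

Lemma pert_graph_le x z : pert_graph x z -> rnorm x <= 2 * rnorm z.
Proof.
move=> /pert_graph_dist; rewrite rdistC; have := rnormD (x - z) z.
by rewrite subrK; lra.
Qed.

Lemma pert_graph_ge x z : pert_graph x z -> rnorm z <= 2 * rnorm x.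
Proof.
move=> /pert_graph_dist; have := rnormD (z - x) x; have := rnorm_ge0 x.
by rewrite subrK; lra.
Qed.

Lemma pert_graph_total x : exists z, pert_graph x z.
Proof.
apply: (@cauchy_seq_lim_tail _ _ _ (fun k => rnorm x / 2 * 2^-1 ^+ k)).
  move=> eps eps0; have x0 := rnorm_ge0 x.
  have x1 : 0 < rnorm x + 1 by lra.
  have [K /(_ K (leqnn K)) hK] := half_lt (divr_gt0 eps0 x1).
  exists K; have : 0 < (2^-1 : R) ^+ K by rewrite exprn_gt0.
  move: hK; rewrite ltr_pdivlMr //; set t := _ ^+ K => h1 h2.
  by have := mulr_ge0 x0 (ltW h2); lra.
move=> k l kl; rewrite /pertI opprD addrACA subrr add0r.
rewrite (big_cat_nat (leq0n k) kl) addrC addKr.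
exact: rnorm_pert_sum.
Qed.

Definition pert_space : set H :=
  [set z | exists2 x, ospan ip e x & pert_graph x z].

Lemma pert_space_submod : submod_closed [in pert_space].
Proof.
have [sp0 spP] := (submod_closedP _).1 (ospan_submod ip_norm e_on).
apply/submod_closedP; split; first by exists 0 => //; exact: pert_graph0.
move=> a z w [x xO xz] [y yO yw]; exists (a *: x + y); first exact: spP.
exact: pert_graphP.
Qed.

(** As the map is bounded below, preimages of a convergent sequence are Cauchy; their limit stays in
    the closed span, and continuity of the map identifies its image. *)
Lemma pert_space_closed : closed pert_space.
Proof.
apply/closedP => z zM.
have /choice[x xP] : forall n : nat, exists x, ospan ip e x /\
    exists2 w, pert_graph x w & rnorm (z - w) < 2^-1 ^+ n.
  move=> n; have [|w [x xO xw] zw] := zM (2^-1 ^+ n); first by rewrite exprn_gt0.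
  by exists x; split=> //; exists w.
have [x0 xx0] : exists x0, seq_lim x x0.
  apply: cauchy_seq_lim => eps eps0; have e8 : 0 < eps / 8 by rewrite divr_gt0.
  have [K hK] := half_lt e8; exists K => k l /hK Kk /hK Kl.
  have [_ [w xw zw]] := xP k; have [_ [w' xw' zw']] := xP l.
  have := pert_graph_le (pert_graphB xw xw').
  by have := rnormD (w - z) (z - w'); rewrite subrKA (rdistC w z); lra.
exists x0.
  apply: ((closedP _).1 (ospan_closed ip_norm e_on)) => eps /xx0[K /(_ K (leqnn K)) hK].
  by exists (x K); [have [] := xP K | rewrite rdistC].
have [z' x0z'] := pert_graph_total x0.
suff -> : z = z' by [].
apply/eqP; rewrite -subr_eq0; apply/eqP/rnorm_le_eps => eps eps0.
have e4 : 0 < eps / 4 by rewrite divr_gt0.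
have [K hK] := half_lt e4; have [K' hK'] := xx0 _ e4.
have [_ [w xw zw]] := xP (maxn K K').
have := pert_graph_ge (pert_graphB xw x0z').
have := hK' _ (leq_maxr K K'); have := hK _ (leq_maxl K K').
by have := rnormD (z - w) (w - z'); rewrite subrKA; lra.
Qed.

(** The lower bound makes the map injective, so a relation between the images of the [e j] would be
    one between the [e j]. *)
Lemma pert_space_infinite_dimensional : infinite_dimensional pert_space.
Proof.
have /choice[f ef] : forall j, exists z, pert_graph (e j) z.
  by move=> j; apply: pert_graph_total.
apply: (@infinite_dimensional_free _ _ _ f) => [j|n a af0 j].
  by exists (e j) => //; apply: ospan_onb.
have /pert_graph_le := @pert_graph_sum n a (e \o val) (f \o val) (fun=> ef _).
rewrite /= af0 rnorm0 mulr0 => ae0.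
have {}ae0 : \sum_(j < n) a j *: e j = 0.
  by apply: rnorm_le_eps => eps /ltW; apply: le_trans.
have := congr1 (ip^~ (e j)) ae0; rewrite linear0l ip_suml (bigD1 j) //=.
rewrite e_on eqxx mulr1 big1 ?addr0 // => i /eqP ij.
by rewrite e_on; case: eqP => [/val_inj//|_]; rewrite mulr0.
Qed.

End Perturbation.

(** * Subspaces of universal vectors *)

Section UniversalSubspace.
Variables (R : realType) (H : completeNormedModType R[i]).
Variables (ip : {dot H for Num.conj}) (ip_norm : norm_from_dot ip).
Variables (L : nat -> {linear H -> H}) (Lbnd : forall k, bounded_linear (L k)).
Variable X : set H.
Hypothesis X_dense : dense X.
Hypothesis LX : forall x, X x -> seq_lim (fun k => L k x) 0.
Hypothesis L_hit : forall y (eps : R) K, 0 < eps ->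
  exists k u, [/\ (K <= k)%N, X u, rnorm u <= eps & rnorm (L k u - y) <= eps].

(** Here [e p + d p] lies in [X]. The conditional [e p] reflects the order of choice: for [p <= i]
    the operator of stage [i] is chosen to be small on [e p + d p], while for [p > i] the later
    [d p] is chosen small for it. *)
Lemma exists_stages (e w : nat -> H) :
  exists (k : nat -> nat) (u d : nat -> H),
    [/\ forall p, rnorm (u p) <= 8^-1 * 2^-1 ^+ p,
        forall p, rnorm (d p) <= 8^-1 * 2^-1 ^+ p,
        forall i p, rnorm (L (k i) (u p) - if p == i then w i else 0)
          <= 2^-1 ^+ i * 2^-1 ^+ p &
        forall i p, rnorm (L (k i) ((if (p <= i)%N then e p else 0) + d p))
          <= 2^-1 ^+ i * 2^-1 ^+ p].
Proof.
(* The square in [eps i] yields the bound [h i * h p] for all [p <= i] at once, and the factor [1/8]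
   yields the size bounds. *)
pose h i := (2^-1 : R) ^+ i; pose eps i : R := 8^-1 * (h i * h i).
have h0 i : 0 < h i by rewrite exprn_gt0.
have h1 i : h i <= 1 by rewrite exprn_ile1 ?invr_ge0 ?invf_le1 ?ler1n.
have hh p i : (p <= i)%N -> h i <= h p.
  by move=> pi; rewrite ler_wiXn2l ?invr_ge0 ?invf_le1 ?ler1n.
have hM p i : (p <= i)%N -> h i * h i <= h i * h p.
  by move=> /hh pi; rewrite ler_pM2l.
have eps0 i : 0 < eps i by rewrite /eps !mulr_gt0 ?invr_gt0.
have eps8 i : eps i <= 8^-1 * h i.
  by rewrite ler_pM2l ?invr_gt0 // -[leRHS]mulr1 ler_pM2l.
have epsh p i : (p <= i)%N -> eps i <= h i * h p.
  by move=> /hM; have := mulr_gt0 (h0 i) (h0 i); rewrite /eps; lra.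
(* A triple holds [k i], [u i] and a vector of [X] standing for [e i + d i]. *)
have [|f [fG fB]] := @pairwise_choice (nat * H * H) (0%N, 0, 0)
    (fun i t => [/\ X t.1.2 /\ X t.2, rnorm t.1.2 <= eps i,
       rnorm (t.2 - e i) <= eps i, rnorm (L t.1.1 t.1.2 - w i) <= eps i &
       rnorm (L t.1.1 t.2) <= eps i])
    (fun p i s t => [/\ rnorm (L s.1.1 t.1.2) <= eps i,
       rnorm (L s.1.1 (t.2 - e i)) <= eps i,
       rnorm (L t.1.1 s.1.2) <= eps i & rnorm (L t.1.1 s.2) <= eps i]).
  move=> s sG _; set n := size s.
  (* Order of choice: a radius [a] harmless for the earlier operators, then [x] in [X] within [a] of
     [e n], then [K] beyond which the operators are small on [x] and all earlier vectors, and last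
     [k >= K] with its [u]. *)
  have [a [a0 aeps ha]] :=
    small_ball Lbnd [seq t.1.1 | t <- s] (eps0 n).
  have [x Xx ex] := (denseP X).1 X_dense (e n) _ a0.
  have xs_X y : y \in x :: [seq t.1.2 | t <- s] ++ [seq t.2 | t <- s] -> X y.
    rewrite inE mem_cat => /orP[/eqP->//|/orP[]] /mapP[t /(nthP (0%N, 0, 0))];
      by move=> [i si <-] ->; have [[]] := sG _ si.
  have [K hK] := eventually_small LX xs_X (eps0 n).
  have [k [u [Kk Xu ua Lu]]] := L_hit (w n) K a0.
  have mem_s p : (p < n)%N -> nth (0%N, 0, 0) s p \in s by move=> pn; rewrite mem_nth.
  exists (k, u, x); split=> /= [|p pn].
    split=> //; first exact: le_trans aeps.
    - by rewrite rdistC (le_trans _ aeps) // ltW.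
    - exact: le_trans aeps.
    - by apply: hK; rewrite ?mem_head.
  split.
  - by apply: ha => //; apply: (map_f (fun t : nat * H * H => t.1.1)); exact: mem_s.
  - apply: ha; last by rewrite rdistC ltW.
    by apply: (map_f (fun t : nat * H * H => t.1.1)); exact: mem_s.
  - apply: hK => //; rewrite inE mem_cat.
    by rewrite (map_f (fun t : nat * H * H => t.1.2)) ?orbT ?mem_s.
  - apply: hK => //; rewrite inE mem_cat.
    by rewrite (map_f (fun t : nat * H * H => t.2)) ?orbT ?mem_s.
exists (fun i => (f i).1.1), (fun i => (f i).1.2), (fun i => (f i).2 - e i).
split=> [p|p|i p|i p].
- by have [_ h2 _ _ _] := fG p; apply: le_trans (eps8 p).
- by have [_ _ h2 _ _] := fG p; apply: le_trans (eps8 p).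
- case: eqVneq => [->|]; last rewrite neq_ltn subr0 => /orP[pi|ip'].
  + by have [_ _ _ h2 _] := fG i; apply: le_trans (epsh _ _ (leqnn _)).
  + by have [_ _ h2 _] := fB _ _ pi; apply: le_trans (epsh _ _ (ltnW pi)).
  + have [h2 _ _ _] := fB _ _ ip'; rewrite mulrC.
    by apply: le_trans (epsh _ _ (ltnW ip')).
- have [pi|ip'] := leqP p i; last first.
    have [_ h2 _ _] := fB _ _ ip'; rewrite add0r mulrC.
    by apply: le_trans (epsh _ _ (ltnW ip')).
  rewrite addrC subrK; apply: le_trans (epsh _ _ pi).
  have [_ _ _ _ h2] := fG i; move: pi; rewrite leq_eqVlt => /orP[/eqP->//|pi].
  by have [] := fB _ _ pi.
Qed.

Section Estimate.
Variables (e : nat -> H) (e_on : orthonormal_seq ip e) (C : R).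
Hypothesis L_ospan : forall k z, ospan ip e z -> rnorm (L k z) <= C * rnorm z.
Variables (w : nat -> H) (m : nat -> nat).
Variables (k : nat -> nat) (u d : nat -> H).
Hypothesis Lu : forall i p, rnorm (L (k i) (u p) - if p == i then w i else 0)
  <= 2^-1 ^+ i * 2^-1 ^+ p.
Hypothesis Led : forall i p,
  rnorm (L (k i) ((if (p <= i)%N then e p else 0) + d p))
  <= 2^-1 ^+ i * 2^-1 ^+ p.

Lemma pert_graph_orbit x z i : ospan ip e x -> pert_graph ip e m u d x z ->
  rnorm (L (k i) z - ip x (e (m i)) *: w i)
  <= C * rnorm (x - oproj ip e i.+1 x) + 4 * rnorm x * 2^-1 ^+ i.
Proof.
move=> xO xz.
apply: (seq_lim_le (K := i.+1) (bounded_linear_lim (Lbnd (k i)) xz)) => N iN /=.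
(* Moving the terms [e p] with [p <= i] from [x] into the sum leaves the tail of [x], and [i.+1]
   makes the projection include index [i]. Subtracting the target cancels the main part of the term
   [p = i]. *)
have -> : L (k i) (pertI ip e m u d N x) - ip x (e (m i)) *: w i =
    L (k i) (x - oproj ip e i.+1 x) + \sum_(0 <= p < N)
      (ip x (e p) *: L (k i) ((if (p <= i)%N then e p else 0) + d p) +
       ip x (e (m p)) *: (L (k i) (u p) - if p == i then w i else 0)).
  have -> : oproj ip e i.+1 x =
      \sum_(0 <= p < N) ip x (e p) *: (if (p <= i)%N then e p else 0).
    rewrite /oproj (big_nat_widen _ _ _ _ _ iN) big_mkcond; apply: eq_bigr => p _.
    by rewrite /= ltnS; case: leqP; rewrite ?scaler0.
  have -> : ip x (e (m i)) *: w i = \sum_(0 <= p < N)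
      ip x (e (m p)) *: (if p == i then w i else 0).
    rewrite (bigD1_seq i) ?mem_index_iota ?iota_uniq //= eqxx big1 ?addr0 //.
    by move=> p /negbTE ->; rewrite scaler0.
  rewrite /pertI !linearD !linearN !linear_sum /= -!addrA; congr (_ + _).
  rewrite -!big_split; apply: eq_bigr => p _ /=.
  rewrite /pert linearD !linearZ /= linearD scalerDr scalerBr.
  by rewrite !scalerN !addrA addNr add0r.
have x0 := rnorm_ge0 x.
rewrite (le_trans (rnormD _ _)) // lerD //.
  apply: L_ospan; have := ospan_submod ip_norm e_on => osub.
  rewrite addrC -scaleN1r; apply: ((submod_closedP (ospan ip e)).1 osub).2 => //.
  by apply: (submod_sum osub) => p _; apply: (submodZ osub); apply: ospan_onb.
rewrite (le_trans (rnorm_sum _ _ _)) //.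
(* Two errors per index and the geometric factor [2] produce the constant [4]. *)
apply: (@le_trans _ _ (\sum_(0 <= p < N) 2 * rnorm x * 2^-1 ^+ i * 2^-1 ^+ p)).
  apply: ler_sum => p _; rewrite (le_trans (rnormD _ _)) // !rnormZ.
  have := ler_pM (rnorm_ge0 _) (rnorm_ge0 _) (rnorm_coef ip_norm e_on x p) (Led i p).
  have := ler_pM (rnorm_ge0 _) (rnorm_ge0 _) (rnorm_coef ip_norm e_on x (m p)) (Lu i p).
  by lra.
rewrite -mulr_sumr.
have t0 : 0 <= 2 * rnorm x * 2^-1 ^+ i by rewrite !mulr_ge0 // exprn_ge0.
by have := ler_wpM2l t0 (sum_half_le R 0 N); rewrite expr0; lra.
Qed.

End Estimate.

Lemma exists_universal_subspace (A : set H) (y : nat -> H) :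
  inf_dim_closed_subspace A ->
  (forall z, A z -> exists C : R, forall k, rnorm (L k z) <= C) ->
  (forall x (eps : R), 0 < eps -> exists l, rnorm (x - y l) < eps) ->
  exists2 M : set H, inf_dim_closed_subspace M &
    forall z, M z -> z <> 0 -> forall v (eps : R), 0 < eps ->
      exists k, rnorm (v - L k z) < eps.
Proof.
move=> [As Ac Ainf] Abnd y_dense.
have [e e_on eA] := exists_orthonormal ip_norm As Ainf.
have [C LC] := uniform_boundedness Lbnd As Ac Abnd.
have L_ospan j z : ospan ip e z -> rnorm (L j z) <= C * rnorm z.
  by move=> /(ospan_sub As Ac eA); apply: LC.
have [s sP] := exists_recurrent (0%N, 0%N).
have [k [u [d [hu hd Lu Led]]]] := exists_stages e (fun i => y (s i).2).
exists (pert_space ip e (fun i => (s i).1) u d).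
  split.
  - exact: pert_space_submod.
  - exact: pert_space_closed.
  - exact: pert_space_infinite_dimensional.
move=> z [x xO xz] z0 v eps eps0.
have [j xj] : exists j, ip x (e j) <> 0.
  apply: contrapT => hx; apply: z0; apply: rnorm_le_eps => a a0.
  have x0 : x = 0.
    apply: (ospan_eq0 xO) => j; apply: contrapT => xj.
    by apply: hx; exists j.
  have := pert_graph_ge ip_norm e_on hu hd xz.
  by rewrite x0 rnorm0 mulr0 => /le_trans; apply; apply: ltW.
set c := ip x (e j) in xj; have c0 := rnorm_gt0 xj.
(* The orbit will approach [c *: y l], so the target has to approximate [c^-1 *: v], with the
   tolerance divided by the modulus of [c]. *)
have [l vl] := y_dense (c^-1 *: v) _ (divr_gt0 eps0 (mulr_gt0 (ltr0Sn _ 1) c0)).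
have {}vl : rnorm (v - c *: y l) < eps / 2.
  have -> : v - c *: y l = c *: (c^-1 *: v - y l).
    by rewrite scalerBr scalerA divff ?scale1r //; apply/eqP.
  by rewrite rnormZ mulrC -ltr_pdivlMr // -mulrA -invfM.
(* [C] may have any sign, hence the absolute value; adding [1] permits the division. *)
have C1 : 0 < `|C| + 1 by rewrite ltr_wpDl.
have x1 : 0 < 4 * (rnorm x + 1) by have := rnorm_ge0 x; lra.
have eps4 : 0 < eps / 4 by rewrite divr_gt0.
have [K1 hK1] := xO _ (divr_gt0 eps4 C1).
have [K2 hK2] := half_lt (divr_gt0 eps4 x1).
(* Recurrence gives a late stage serving coefficient [j] and target [l]. The errors add up to less
   than [eps / 2 + eps / 4 + eps / 4]. *)
have [i iK si] := sP (j, l) (maxn K1 K2).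
move: iK; rewrite geq_max => /andP[iK1 /hK2 xi].
have := hK1 i.+1 (leqW iK1); rewrite rdistC => Ci.
exists (k i); have := pert_graph_orbit e_on L_ospan Lu Led i xO xz.
rewrite si /= -/c.
set r := rnorm (x - _) in Ci *; have r0 : 0 <= r by apply: rnorm_ge0.
move: Ci; rewrite ltr_pdivlMr // => Ci.
move: xi; rewrite ltr_pdivlMr // => xi.
have h0 : 0 < (2^-1 : R) ^+ i by rewrite exprn_gt0.
have Cr : C * r <= `|C| * r by rewrite ler_wpM2r // ler_norm.
have := rnormD (v - c *: y l) (c *: y l - L (k i) z).
by rewrite subrKA (rdistC (c *: y l)); lra.
Qed.

End UniversalSubspace.

(** * Scaled iterates of an operator *)

Section ScaledIterates.
Variables (R : realType) (H : completeNormedModType R[i]) (T : {linear H -> H}).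

Lemma scaled_iter_is_linear (a : R[i]) n : linear (fun x => a *: iter n T x).
Proof.
have iterP b x y : iter n T (b *: x + y) = b *: iter n T x + iter n T y.
  by elim: n => //= n ->; rewrite linearP.
by move=> b x y; rewrite iterP scalerDr !scalerA mulrC.
Qed.

Definition scaled_iter (a : R[i]) n : H -> H := fun x => a *: iter n T x.

HB.instance Definition _ a n :=
  GRing.isLinear.Build R[i] H H _ (scaled_iter a n) (scaled_iter_is_linear a n).

Lemma scaled_iter_bounded a n : bounded_operator T -> bounded_linear (scaled_iter a n).
Proof.
move=> [C hC]; pose D := rnorm C + 1.
have D0 : 0 < D by rewrite ltr_wpDl ?rnorm_ge0.
have TD x : rnorm (T x) <= D * rnorm x.
  apply: (@le_trans _ _ (rnorm C * rnorm x)).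
    (* [C] is complex, but [C * |x|] dominates a norm, so it is a nonnegative real and equals its
       own modulus. *)
    have Cx := hC x; have Cx0 := le_trans (normr_ge0 _) Cx.
    rewrite -lecR rmorphM /= !rnormE (le_trans Cx) //.
    by rewrite -[leLHS]ger0_norm // normrM normr_id.
  by rewrite ler_wpM2r ?rnorm_ge0 // lerDl.
exists ((rnorm a + 1) * D ^+ n).
  by rewrite mulr_gt0 ?exprn_gt0 // ltr_wpDl ?rnorm_ge0.
move=> x; rewrite /scaled_iter rnormZ -mulrA ler_pM ?rnorm_ge0 ?lerDl //.
elim: n => [|n IH]; first by rewrite expr0 mul1r.
by rewrite iterS (le_trans (TD _)) // exprS -mulrA ler_pM2l.
Qed.

End ScaledIterates.

(** * From the criterion to the scaled iterates *)

Section Bridge.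
Variables (R : realType) (H : completeNormedModType R[i]).

Lemma cvg_norm_seq_lim (f : nat -> H) :
  `|f k| @[k --> \oo] --> (0 : R[i]^o) -> seq_lim f 0.
Proof.
move=> /cvgrPdist_lt f0 e e0.
have e0' : 0 < e%:C by rewrite ltcR.
have [K _ hK] := f0 _ e0'; exists K => k /hK /=.
by rewrite subr0 sub0r normrN normr_id -rnormE ltcR.
Qed.

Lemma seq_lim_bounded (f : nat -> H) z :
  seq_lim f z -> exists C : R, forall k, rnorm (f k) <= C.
Proof.
move=> /(_ 1 ltr01)[K hK].
have S0 n : 0 <= \sum_(0 <= j < n) rnorm (f j) by apply: sumr_ge0 => j _; apply: rnorm_ge0.
exists (\sum_(0 <= j < K) rnorm (f j) + (rnorm z + 1)) => k.
have z0 := rnorm_ge0 z; have [/hK fk|kK] := leqP K k.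
  by have := rnormD (f k - z) z; rewrite subrK; have := S0 K; lra.
rewrite (bigD1_seq k) ?mem_index_iota ?iota_uniq //= -addrA lerDl addr_ge0 //.
  by apply: sumr_ge0 => j _; apply: rnorm_ge0.
by rewrite addr_ge0.
Qed.

Lemma separable_dense_seq : separable_space H ->
  exists y : nat -> H, forall x (eps : R), 0 < eps -> exists l, rnorm (x - y l) < eps.
Proof.
move=> [D [/countable_injP[f finj] /denseP Dd]].
(* [y] inverts the injection of [D] into the naturals, with arbitrary values outside its image. *)
have /choice[y yP] : forall l, exists x, (exists2 x', D x' & f x' = l) -> D x /\ f x = l.
  move=> l; have [[x Dx fx]|] := pselect (exists2 x', D x' & f x' = l).
    by exists x.
  by exists 0.
exists y => x eps eps0; have [x' Dx' xx'] := Dd x _ eps0.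
exists (f x'); have [|Dy fy] := yP (f x'); first by exists x'.
by have -> : y (f x') = x' by apply: finj; rewrite ?in_setE.
Qed.

Variables (T : {linear H -> H}) (Tbnd : bounded_operator T).
Variables (n : nat -> nat) (lam : nat -> R[i]).

(** The vector [lam^-1 *: S y'] is small and the scaled iterate sends it to [T^n (S y')], close to
    [y']. As it may lie outside [X], a nearby point of [X] replaces it. *)
Lemma criterion_hit (X Y : set H) (S : nat -> H -> H) :
  dense X -> dense Y -> (forall k, lam (n k) != 0) ->
  (forall y, Y y -> `|(lam (n k))^-1 *: S (n k) y| @[k --> \oo] --> (0 : R[i]^o)) ->
  (forall y, Y y -> iter (n k) T (S (n k) y) @[k --> \oo] --> y) ->
  forall y (eps : R) K, 0 < eps -> exists k u, [/\ (K <= k)%N, X u,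
    rnorm u <= eps & rnorm (scaled_iter T (lam (n k)) (n k) u - y) <= eps].
Proof.
move=> /denseP Xd /denseP Yd lam0 S0 TS y eps K eps0.
have eps3 : 0 < eps / 3 by rewrite divr_gt0.
have [y' Yy' yy'] := Yd y _ eps3.
have [K1 hK1] := cvg_norm_seq_lim (S0 _ Yy') eps3.
have [K2 hK2] := cvg_seq_lim (TS _ Yy') eps3.
pose k := maxn K (maxn K1 K2).
have := hK1 k; rewrite /k !leq_max leqnn orbT subr0 => /(_ isT).
have := hK2 k; rewrite /k !leq_max leqnn !orbT => /(_ isT).
rewrite -/k; set v := _ *: S _ _ => Tv v3.
have Lv : scaled_iter T (lam (n k)) (n k) v = iter (n k) T (S (n k) y').
  by rewrite /v linearZ /= /scaled_iter scalerA mulVf ?scale1r.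
(* The index [k] is already fixed, so continuity of this single operator gives the radius. *)
have [d d0 hd] :=
  bounded_linear_small (scaled_iter_bounded (lam (n k)) (n k) Tbnd) eps3.
have de : 0 < Num.min d (eps / 3) by rewrite lt_min d0.
have [u Xu] := Xd v _ de; rewrite lt_min => /andP[/ltW/hd vu vu'].
exists k, u; split=> //; first by rewrite leq_maxl.
  by have := rnormD (u - v) v; rewrite subrK rdistC; lra.
move: vu; rewrite linearB /= Lv => vu.
set Lu := scaled_iter T _ _ u in vu *; set w := iter _ _ _ in Tv vu.
have := rnormD (Lu - w) (w - y') ; have := rnormD (Lu - y') (y' - y).
by rewrite !subrKA (rdistC Lu w) (rdistC y' y); lra.
Qed.

End Bridge.

Theorem theorem3p5 (R : realType) (H : completeNormedModType R[i])
    (ip : {dot H for Num.conj}) (T : {linear H -> H})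
    (n : nat -> nat) (lam : nat -> R[i]) :
  norm_from_dot ip ->
  separable_space H ->
  infinite_dimensional [set: H] ->
  bounded_operator T ->
  diskcyclicity_criterion T n lam ->
  condition_B1 T n lam \/ bounded_orbits_condition T n lam ->
  exists M : set H, inf_dim_closed_subspace M /\
    forall x, M x -> x <> 0 -> diskcyclic_vector T x.
Proof.
move=> ip_norm Hsep _ Tbnd [_ _ hlam [X [Y [S [[Xd Yd] TX S0 TS]]]]] hcond.
pose L k : {linear H -> H} := scaled_iter T (lam (n k)) (n k).
have Lbnd k : bounded_linear (L k) by apply: scaled_iter_bounded.
have LX x : X x -> seq_lim (fun k => L k x) 0.
  by move=> /TX /cvg_norm_seq_lim.
have lam0 k : lam (n k) != 0 by have [] := hlam k.
have L_hit := criterion_hit Tbnd Xd Yd lam0 S0 TS.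
have [y y_dense] := separable_dense_seq Hsep.
have [A Asub Abnd] : exists2 A : set H, inf_dim_closed_subspace A &
    forall z, A z -> exists C : R, forall k, rnorm (L k z) <= C.
  case: hcond => [[A [Asub Az]]|[A [Asub Az]]]; exists A => // z /Az.
    by move=> /cvg_norm_seq_lim /seq_lim_bounded.
  move=> [C hC]; exists (rnorm C) => k; rewrite le_rnorm.
  by rewrite (le_trans (hC k)) // ger0_norm // (le_trans (normr_ge0 _) (hC k)).
have [M Msub Mhit] :=
  exists_universal_subspace ip_norm Lbnd Xd LX L_hit Asub Abnd y_dense.
exists M; split=> // x Mx x0; apply/denseP => v eps eps0.
have [k vk] := Mhit x Mx x0 v eps eps0.
(* The modulus of [lam (n k)] is at most [1], so [L k x] belongs to the disk orbit of [x]. *)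
exists (L k x) => //; exists (n k), (lam (n k)); split=> //.
by have [] := hlam k.
Qed.
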